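(* No randomized BLS phase algorithm (with access to a PST oracle whose prediction error is at most $\eta_0$) has competitive ratio lower than $H_m$ on uniform metrical task systems, where $m=Z^{-1}(\eta_0)=\lfloor\sqrt{2\eta_0+1}\rfloor$ and $H_m=\sum_{j=1}^m \frac1j$ is the $m$-th harmonic number.
   Context: Uniform metrical task system: a finite set $S$ of $n$ states with transition costs $d(s,s')=1$ for $s\ne s'$ and $d(s,s)=0$. A task is an array $T$ of length $n$, where $T[i]$ is the cost of processing it in state $s_i$. The input is a sequence of tasks, one per time step; an online algorithm chooses at each time $t$ a (possibly random) state $\sigma(t)$, knowing only the tasks up to time $t$, its past states, and any oracle advice; its cost on a sequence is the sum over $t$ of $d(\sigma(t-1),\sigma(t))$ and of the processing cost of the $t$-th task in $\sigma(t)$, with $\sigma(0)=s_1$. The competitive ratio of a randomized algorithm is the infimum of all $w$ such that it is $w$-competitive in expectation, i.e. in the standard worst-case sense with its expected cost compared to the cost of the optimal offline algorithm. Phases and saturation: at the start of a phase all states are unsaturated. A state $s$ is saturated at time $t$ if the total cost of processing, in state $s$, all tasks arriving from the start of the phase through time $t$ is at least $1$; its saturation time in the phase is the first such $t$. When all states are saturated the next phase begins and all states are again unsaturated. A BLS phase algorithm is an algorithm that runs in phases, never processes tasks in a saturated state, and only leaves its current state when that state becomes saturated; a randomized one may choose at random the unsaturated state it moves to. PST (Predicted Saturation Time) oracle: at the beginning of each phase it outputs an array $h$ without ties, where $h[i]$ is the predicted saturation time of state $s_i$ in that phase. If $t_i$ is the true saturation time of $s_i$, the prediction error is $\eta=\sum_{i=1}^n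 |h[i]-t_i|$. In the worst-case analysis an adversary chooses both the task sequence and the oracle's predictions, subject to $\eta\le\eta_0$. *)

(* Defs.v *)
(* MathComp / MathComp-Analysis *)
From HB Require Import structures.
From mathcomp Require Export all_boot all_order all_algebra.
From mathcomp Require Export all_classical all_reals all_analysis.

Set Implicit Arguments.
Unset Strict Implicit.
Unset Printing Implicit Defensive.

Import Order.TTheory GRing.Theory Num.Theory.

Local Open Scope classical_set_scope.
Local Open Scope ring_scope.

(* Time steps are 1, 2, ...; time 0 only carries the initial state, so the
   value T 0 of a task sequence is never used.  A prediction sequence lists one
   array per phase, phases being numbered from 0. *)
Definition task (R : realType) (S : finType) : Type := S -> R.
Definition task_seq (R : realType) (S : finType) : Type := nat -> task R S.
Definition prediction (S : finType) : Type := S -> nat.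
Definition prediction_seq (S : finType) : Type := nat -> prediction S.

Section Phases.
Variables (R : realType) (S : finType).
Implicit Types (T : task_seq R S) (h : prediction_seq S) (s : S).

Definition load T (a t : nat) s : R := \sum_(a.+1 <= u < t.+1) T u s.

(* Saturation in the phase whose tasks are those at times a + 1, a + 2, ... *)
Definition saturated T (a t : nat) s : bool := 1 <= load T a t s.

(* The a such that the tasks of the phase in force at time t are those from
   time a + 1 on.  The task that saturates the last unsaturated state at time t
   belongs to the phase it ends; the next phase is already in force at time t,
   where all states are unsaturated again. *)
Fixpoint phase_start T (t : nat) : nat :=
  if t is u.+1 then
    if [forall s, saturated T (phase_start T u) t s] then t
    else phase_start T u
  else 0%N.

(* The number of the phase in force at time t. *)
Fixpoint phase_index T (t : nat) : nat :=
  if t is u.+1 then (phase_index T u + (phase_start T t == t))%N else 0%N.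

Definition saturation_time T (a : nat) s (t : nat) : Prop :=
  saturated T a t s /\ (forall u, saturated T a u s -> (t <= u)%N).

(* The equation phase_start T a = a says that a phase starts at time a.  Every
   phase that starts is required to end, so that its true saturation times, and
   hence the error of its prediction, are defined; costs are measured on finite
   prefixes of such sequences. *)
Definition error_at_most (eta0 : nat) T h : Prop :=
  forall a : nat, phase_start T a = a ->
  exists t : S -> nat,
    (forall s, saturation_time T a s (t s)) /\
    (\sum_(s : S) `|h (phase_index T a) s - t s| <= eta0)%N.

Definition valid_tasks T : Prop := forall t s, 0 <= T t s.

Definition tie_free h : Prop := forall k, injective (h k).

Definition path_cost T (sigma : nat -> S) (N : nat) : R :=
  \sum_(1 <= t < N.+1)
    ((sigma t.-1 != sigma t)%:R + T t (sigma t)).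

Definition opt_cost (s1 : S) T (N : nat) : R :=
  inf [set path_cost T sigma N | sigma in [set sigma | sigma 0%N = s1]].

End Phases.

(* The sample w carries all the random choices.  At time t the algorithm is
   given the tasks at times 1, ..., t, the predictions of the phases started so
   far, and its states at times 0, ..., t - 1, in chronological order. *)
Record rand_alg (R : realType) (S : finType) (d : measure_display)
    (Omega : measurableType d) := RandAlg {
  decide :> Omega -> seq (task R S) -> seq (prediction S) -> seq S -> S;
  measurable_decide : forall ts hs past s,
    measurable [set w | decide w ts hs past = s]
}.

Section Algorithms.
Variables (R : realType) (S : finType) (s1 : S).
Variables (d : measure_display) (Omega : measurableType d).
Implicit Types (A : rand_alg R S Omega) (T : task_seq R S)
  (h : prediction_seq S).

Fixpoint history A T h (w : Omega) (t : nat) : seq S :=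
  if t is u.+1 then
    let past := history A T h w u in
    rcons past (A w [seq T v | v <- iota 1 t]
                    [seq h k | k <- iota 0 (phase_index T t).+1] past)
  else [:: s1].

Definition state A T h (w : Omega) (t : nat) : S := last s1 (history A T h w t).

(* At a time t + 1 that ends a phase, the first clause refers to the new phase
   and the second one to the phase that has just ended. *)
Definition bls_phase A : Prop :=
  forall (w : Omega) T h, valid_tasks T -> tie_free h -> forall t : nat,
    ~~ saturated T (phase_start T t.+1) t.+1 (state A T h w t.+1) /\
    (state A T h w t.+1 != state A T h w t ->
     saturated T (phase_start T t) t.+1 (state A T h w t)).

Definition competitive (P : probability Omega R) (eta0 : nat) A (w : R) :
    Prop :=
  exists c : R, forall T h, valid_tasks T -> tie_free h ->
    error_at_most eta0 T h -> forall N : nat,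
    ('E_P[fun x => path_cost T (state A T h x) N]
       <= (w * opt_cost s1 T N + c)%:E)%E.

Definition competitive_ratio (P : probability Omega R) (eta0 : nat) A : \bar R :=
  ereal_inf [set w%:E | w in [set w | competitive P eta0 A w]].

End Algorithms.

(* Main.v *)
Require Import Defs.
From mathcomp Require Import all_boot all_order all_algebra.
From mathcomp Require Import all_classical all_reals all_analysis.
From mathcomp Require Import zify lra measurable_realfun.
Local Open Scope ring_scope.

Set Implicit Arguments.
Unset Strict Implicit.
Unset Printing Implicit Defensive.

Import Order.TTheory GRing.Theory Num.Theory.

(** A deterministic adversary, which knows the distribution of the algorithm's
states, saturates one state per time step by a unit task. In a phase it first
saturates [#|S| - m] states in the predicted order, and then repeatedly the
unsaturated state that the algorithm occupies with the largest probability.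
With [k] unsaturated states left the algorithm pays at least [1] with
probability at least [1 / k], because a phase algorithm never sits in a
saturated state; this gives [H_m] per phase in expectation. Moving to the state
saturated last costs the offline player [1] per phase. The saturation times
permute the predicted times within a block of length [m], so the error is at
most [floor (m^2 / 2)], which is at most [eta0]. *)

(** * Dependent choice and displacements of a permutation *)

(** It will build the adversary's sequence, where each choice depends on the whole prefix before
    it. *)
Lemma strong_dependent_choice (U : Type) (Q : seq U -> U -> Prop) :
  (forall l, exists x, Q l x) ->
  exists g : nat -> U, forall t, Q (mkseq g t) (g t).
Proof.
move=> /choice[f fQ].
pose fix pref t := if t is u.+1 then rcons (pref u) (f (pref u)) else [::].
exists (fun t => f (pref t)) => t; set g := fun t => _.
suff -> : mkseq g t = pref t by exact: fQ.
by elim: t => // t IHt; rewrite mkseqS IHt.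
Qed.

(** Passing from [m] to [m + 2] shifts the centre by one and adds two end terms [m + 1]; hence an
    induction on pairs of consecutive values. *)
Lemma sum_dist_center (m : nat) :
  (\sum_(i < m) `|2 * i - (m - 1)| = m ^ 2 %/ 2)%N.
Proof.
rewrite -(big_mkord predT (fun i => `|2 * i - (m - 1)|%N)) -/(index_iota 0 m).
suff [H1 H2] : (\sum_(0 <= i < m) `|2 * i - (m - 1)| = m ^ 2 %/ 2)%N /\
  (\sum_(0 <= i < m.+1) `|2 * i - (m.+1 - 1)| = m.+1 ^ 2 %/ 2)%N by [].
elim: m => [|m [IH1 IH2]]; first by rewrite !big_nat1 big_geq.
split=> //; rewrite big_nat_recr//= big_nat_recl//=.
rewrite (eq_big_nat _ _ (F2 := fun i => `|2 * i - (m - 1)|%N)); last first.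
  by move=> i /andP[_ im]; lia.
rewrite IH1.
have -> : (m.+2 ^ 2 = m ^ 2 + (m.+1 + m.+1) * 2)%N by lia.
by move: (m ^ 2)%N => x; lia.
Qed.

(* Compare both [q i] and [i] with the centre [n - m + (m - 1) / 2] of the block
   that [q] permutes; doubling keeps everything integral. *)
Lemma sum_displacement (n m : nat) (q : 'I_n -> 'I_n) : (m <= n)%N ->
  injective q -> (forall i : 'I_n, (i < n - m)%N -> q i = i) ->
  (\sum_(i < n) `|q i - i| <= m ^ 2 %/ 2)%N.
Proof.
move=> mn q_inj q_id.
pose F (i : 'I_n) := (if i < n - m then 0 else `|2 * (i - (n - m)) - (m - 1)|)%N.
have sumF : (\sum_(i < n) F i = m ^ 2 %/ 2)%N.
  rewrite -sum_dist_center.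
  rewrite -(big_mkord predT (fun i => if i < n - m then 0 else `|2 * (i - (n - m))%N - (m - 1)%N|)%N).
  rewrite (big_cat_nat (n := (n - m)%N))//=; last by lia.
  rewrite big_nat_cond big1 => [|i /andP[/andP[_ ->]]]//.
  rewrite add0n -{1}(add0n (n - m)%N) big_addn subKn// big_mkord.
  by apply: eq_bigr => i _; rewrite ifF; lia.
(* Triangle inequality through the centre. Injectivity keeps [q i] in the block, since every index
   below [n - m] is a fixed point. *)
have qF i : (2 * `|q i - i| <= F (q i) + F i)%N.
  rewrite /F; have [im|im] := ltnP i (n - m); first by rewrite q_id; lia.
  have [qim|qim /=] := ltnP (q i) (n - m); last by lia.
  by have /q_inj qi := q_id _ qim; move: qim; rewrite qi; lia.
rewrite -(leq_pmul2l (ltn0Sn 1)) big_distrr/=.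
apply: (@leq_trans (\sum_(i < n) (F (q i) + F i)))%N; first by apply: leq_sum => i _.
have /= qE := reindex_inj (op := addn) (P := predT) (F := F) q_inj.
by rewrite big_split/= -qE sumF; lia.
Qed.

(** * Unit-task sequences whose phases are blocks of [#|S|] steps *)

Section UnitTasks.
Context {R : realType} {S : finType}.
Implicit Types (g : nat -> S) (a t k : nat) (s : S).

(* Indices are shifted: [g t] is the state charged at time [t.+1]. *)
Definition unit_tasks g : task_seq R S := fun t s => (s == g t.-1)%:R.

Lemma valid_unit_tasks g : valid_tasks (unit_tasks g).
Proof. by move=> t s; rewrite ler0n. Qed.

Lemma saturated_unit_tasks g a t s :
  saturated (unit_tasks g) a t s = (s \in [seq g u | u <- index_iota a t]).
Proof.
rewrite /saturated /load big_add1/= -natr_sum ler1n lt0n sum_nat_seq_neq0.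
apply/hasP/mapP => [[u ut]|[u ut ->]]; last by exists u; rewrite ?eqxx.
by rewrite eqb0 negbK => /eqP ->; exists u.
Qed.

(** By cardinality, each block of [#|S|] consecutive charges then hits every state exactly once, and
    so makes up one phase. *)
Definition saturates_blocks g : Prop := forall k,
  {in gtn #|S| &, injective (fun i => g (k * #|S| + i)%N)}.

Variable g : nat -> S.
Hypothesis g_blocks : saturates_blocks g.
Hypothesis S_gt0 : (0 < #|S|)%N.

Let n := #|S|.
Let T := unit_tasks g.

Lemma block_surj k s : exists2 i, (i < n)%N & g (k * n + i)%N = s.
Proof.
have f_inj : injective (fun i : 'I_n => g (k * n + i)%N).
  by move=> i j /g_blocks ij; apply/val_inj/ij; rewrite inE.
have /codomP[i ->] := inj_card_onto f_inj (eq_leq (esym (card_ord n))) s.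
by exists i.
Qed.

Lemma phase_start_unit_tasks t : phase_start T t = (t %/ n * n)%N.
Proof.
elim: t => [|t /= ->]; first by rewrite div0n.
have tE := divn_eq t n; have tn := ltn_pmod t S_gt0; rewrite -/n in tn.
have [tn1|tn1] := eqVneq (t %% n).+1 n.
  have tE1 : t.+1 = ((t %/ n).+1 * n)%N by rewrite mulSn; lia.
  rewrite ifT; first by rewrite {2}tE1 mulnK -?tE1.
  apply/forallP => s; rewrite saturated_unit_tasks.
  have [i i_n <-] := block_surj (t %/ n) s.
  by apply: map_f; rewrite mem_index_iota; lia.
rewrite ifF.
  by rewrite {2}tE -addnS divnMDl ?(divn_small (m := _.+1)) ?addn0//; lia.
apply/negbTE/forallP => all_sat.
(* Fewer than [n] charges cannot saturate [n] states. *)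
suff : (n <= (t %% n).+1)%N by lia.
have -> : (t %% n).+1 = size [seq g u | u <- index_iota (t %/ n * n) t.+1].
  by rewrite size_map size_iota; lia.
rewrite [in leqLHS]/n cardE; apply: uniq_leq_size (enum_uniq _) _ => s _.
by rewrite -saturated_unit_tasks; apply: all_sat.
Qed.

Lemma phase_index_unit_tasks t : phase_index T t = (t %/ n)%N.
Proof.
elim: t => [|t IHt]; first by rewrite div0n.
have -> : phase_index T t.+1 = (phase_index T t + (phase_start T t.+1 == t.+1))%N by [].
by rewrite phase_start_unit_tasks IHt -/n -dvdn_eq divnS// addnC.
Qed.

(** The only charge to [g (k * n + i)] in phase [k] comes at time [(k * n + i).+1], which is
    therefore its true saturation time. *)
Lemma unit_tasks_error eta0 (h : prediction_seq S) :
    (forall k, \sum_(i < n) `|h k (g (k * n + i)) - (k * n + i).+1| <= eta0)%N ->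
  error_at_most eta0 T h.
Proof.
move=> h_err a; rewrite phase_start_unit_tasks phase_index_unit_tasks.
move: (a %/ n)%N => k <-{a}.
have /choice[f fP] s : exists i : 'I_n, g (k * n + i)%N = s.
  by have [i i_n gi] := block_surj k s; exists (Ordinal i_n).
have fK : cancel f (fun i => g (k * n + i)%N) by [].
have gK : cancel (fun i : 'I_n => g (k * n + i)%N) f.
  by move=> i; apply/val_inj/(g_blocks (ltn_ord (f _)) (ltn_ord i))/fP.
exists (fun s => (k * n + f s).+1); split=> [s|].
  split=> [|u]; rewrite saturated_unit_tasks.
    by rewrite -{1}(fP s); apply: map_f; rewrite mem_index_iota; lia.
  case/mapP=> v; rewrite mem_index_iota => /andP[kv vu] sg.
  rewrite ltnNge; apply/negP => uf; have f_n := ltn_ord (f s).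
  have vE : (k * n + (v - k * n))%N = v by lia.
  suff : (v - k * n)%N = f s by lia.
  by apply: (@g_blocks k); rewrite ?inE -/n; try lia; rewrite vE fP.
rewrite (reindex (fun i : 'I_n => g (k * n + i)%N)) /=; last first.
  by exists f => i _; [exact: gK | exact: fK].
apply: leq_trans (h_err k); apply/eq_leq/eq_bigr => i _.
by rewrite gK.
Qed.

Lemma opt_cost_unit_tasks s1 K : opt_cost s1 T (K * n) <= K.+1%:R.
Proof.
(* During a phase the offline player waits in the state saturated last. *)
pose sigma t := if t == 0%N then s1 else g (t %/ n * n + n.-1)%N.
apply: le_trans (_ : path_cost T sigma (K * n) <= _).
  apply: ge_inf; last by exists sigma.
  exists 0 => _ [sigma' _ <-]; apply: sumr_ge0 => t _.
  by rewrite addr_ge0 ?ler0n.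
(* The term [t == 0] pays for leaving [s1]. At the last step of a phase, if [t] is positive,
   [sigma t = g t]: the player either moves away or pays the task, but not both. Other steps with
   [t] positive are free. *)
have step t : ((sigma t != sigma t.+1) + (sigma t.+1 == g t)
    <= (t == 0) + (n %| t.+1))%N.
  have tE := divn_eq t n; have tn := ltn_pmod t S_gt0; rewrite -/n in tn.
  have [t0|t0] := eqVneq t 0%N.
    have [n1|n1] := boolP (n %| t.+1)%N; first by case: eqP; case: eqP.
    suff /negbTE -> : sigma t.+1 != g t by case: eqP.
    have n2 : (1 < n)%N by move: n1; rewrite t0 dvdn1; lia.
    rewrite t0 /sigma/= divn_small// mul0n add0n.
    by apply/eqP => /(@g_blocks 0 n.-1 0); rewrite !inE -/n; lia.
  rewrite {1}/sigma (negbTE t0) add0n.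
  have [nt|nt] := boolP (n %| t.+1)%N.
    suff -> : (t %/ n * n + n.-1 = t)%N by rewrite eq_sym; case: eqP.
    suff : ((t %% n).+1 = n)%N by lia.
    apply/eqP; rewrite eqn_leq tn dvdn_leq//.
    by move: nt; rewrite {1}tE -addnS dvdn_addr ?dvdn_mull.
  rewrite /sigma/= divnS// (negbTE nt) add0n eqxx.
  suff /negbTE -> : g (t %/ n * n + n.-1) != g t by [].
  apply/eqP; rewrite {2}tE => /g_blocks.
  rewrite !inE -/n => tE1; move: nt; rewrite {1}tE -addnS -tE1; [|lia..].
  by rewrite prednK// dvdn_addr ?dvdn_mull ?dvdnn.
suff /(_ (K * n)%N) : forall N, path_cost T sigma N <= ((0 < N) + N %/ n)%:R.
  by move/le_trans; apply; rewrite mulnK// ler_nat; case: (0 < K * n)%N => /=; lia.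
rewrite /path_cost; elim=> [|N IHN]; first by rewrite big_geq ?ler0n.
rewrite big_nat_recr//= (le_trans (lerD IHN (_ : _ <= ((N == 0%N) + (n %| N.+1))%:R)))//.
  by rewrite /T /unit_tasks/= -natrD ler_nat.
rewrite -natrD ler_nat divnS//; case: N {IHN} => [|N]/=; first by rewrite div0n; lia.
by rewrite add0n -addnA [(N.+1 %/ n + _)%N]addnC. 
Qed.
End UnitTasks.

(** * Random variables with countably many values *)

Section CountableFibers.
Context {R : realType} {d : measure_display} {Omega : measurableType d}.
Local Open Scope classical_set_scope.

(** States and histories are given no sigma-algebra: measurability is stated fibre by fibre, and a
    preimage is a countable union of fibres. *)
Lemma measurable_preimage_fibers (U : countType) (X : Omega -> U) (B : set U) :
  (forall u, measurable [set w | X w = u]) -> measurable (X @^-1` B).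
Proof.
move=> mX; have -> : X @^-1` B = \bigcup_u [set w | X w = u /\ B u].
  by apply/seteqP; split=> [w Bw|w [u _ [<-]]//]; exists (X w).
apply: countable_bigcupT_measurable => [|u]; first exact: countableP.
have [Bu|nBu] := pselect (B u).
  by rewrite (_ : mkset _ = [set w | X w = u])//; apply/seteqP; split=> w // [].
by rewrite (_ : mkset _ = set0)//; apply/seteqP; split=> w // [].
Qed.

Lemma measurable_fun_fibers (U : countType) (X : Omega -> U) (f : U -> R) :
  (forall u, measurable [set w | X w = u]) -> measurable_fun setT (f \o X).
Proof.
by move=> mX _ B _; rewrite setTI comp_preimage; exact: measurable_preimage_fibers.
Qed.

(** The probabilities of the values in [C] add up to 1, so an upper bound for all of them is at
    least their average. *)
Lemma mode_prob_ge (P : probability Omega R) (S : finType) (X : Omega -> S)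
    (C : {pred S}) (s0 : S) :
    (forall s, measurable [set w | X w = s]) -> (forall w, X w \in C) ->
    (forall s, s \in C -> P [set w | X w = s] <= P [set w | X w = s0])%E ->
  ((#|C|%:R^-1)%:E <= P [set w | X w = s0])%E.
Proof.
move=> mX XC s0_max.
have : (\int[P]_w (\sum_(s <- enum C) (\1_[set w | X w = s] w)%:E) = 1)%E.
  transitivity (\int[P]_w (1%R)%:E)%E; last first.
    by rewrite integral_cst//= probability_setT mule1.
  apply: eq_integral => w _; rewrite sumEFin big_enum/= (bigD1 (X w))//=.
  rewrite indicE mem_set// big1 ?addr0// => s /andP[_ sX].
  by rewrite indicE memNset//= => /esym/eqP; rewrite (negbTE sX).
rewrite ge0_integral_sum//; first last.
- by move=> s; apply/measurable_EFinP; exact: measurable_indic.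
under eq_bigr do rewrite integral_indic// setIT.
rewrite big_enum/= => sum1.
have P_fin : P [set w | X w = s0] \is a fin_num by exact: fin_num_measure.
have : (1 <= \sum_(s in C) P [set w | X w = s0])%E.
  by rewrite -sum1; apply: lee_sum => s; exact: s0_max.
rewrite -(fineK P_fin) sumEFin !lee_fin sumr_const => le1.
have C_gt0 : (0 < #|C|)%N by case: #|C| le1 => //; rewrite mulr0n ler10.
by rewrite -[leLHS]mul1r ler_pdivrMr ?ltr0n// mulr_natr.
Qed.
End CountableFibers.

(** * Causality, measurability and expected cost of a run *)

Section Histories.
Context {R : realType} {S : finType} {s1 : S}.
Context {d : measure_display} {Omega : measurableType d}.
Variable A : rand_alg R S Omega.
Local Open Scope classical_set_scope.
Implicit Types (T : task_seq R S) (h : prediction_seq S).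

Lemma size_history T h w t : size (history s1 A T h w t) = t.+1.
Proof. by elim: t => //= t IHt; rewrite size_rcons IHt. Qed.

Lemma eq_phase T T' t : {in [pred u | 0 < u <= t]%N, T =1 T'} ->
  forall u, (u <= t)%N ->
  phase_start T u = phase_start T' u /\ phase_index T u = phase_index T' u.
Proof.
move=> TT'; elim=> [//|u IHu] ut; have [ps pi] := IHu (ltnW ut).
have ps1 : phase_start T u.+1 = phase_start T' u.+1.
  rewrite /= ps; congr (if _ then _ else _); apply: eq_forallb => s.
  rewrite /saturated /load; congr (_ <= _); apply: eq_big_nat => v uv.
  by rewrite TT' ?inE//; lia.
by split=> //; rewrite [LHS]/= [RHS]/= pi -!/(phase_start _ u.+1) ps1.
Qed.

(** This causality lets the adversary fix the task of time [t.+1] after computing the distribution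
    of the state at time [t]. *)
Lemma eq_history T T' h w t : {in [pred u | 0 < u <= t]%N, T =1 T'} ->
  history s1 A T h w t = history s1 A T' h w t.
Proof.
move=> TT'; have pE := eq_phase TT'.
elim: t TT' pE => [//|t IHt] TT' pE.
have -> : history s1 A T h w t.+1 = rcons (history s1 A T h w t)
   (A w [seq T v | v <- iota 1 t.+1] [seq h k | k <- iota 0 (phase_index T t.+1).+1]
     (history s1 A T h w t)) by [].
rewrite IHt => [|u u_t|u u_t]; [|apply: TT'; move: u_t; rewrite !inE => u_t; lia|exact/pE/leqW].
rewrite (pE t.+1 (leqnn _)).2.
congr (rcons _ (A w _ _ _)); apply/eq_in_map => u; rewrite mem_iota => u_t.
by apply: TT'; rewrite inE; lia.
Qed.

Lemma measurable_history T h t l :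
  measurable [set w | history s1 A T h w t = l].
Proof.
elim: t l => [|t IHt] l /=.
  have [->|/eqP l_s1] := eqVneq l [:: s1].
    by rewrite (_ : mkset _ = setT)//; apply/seteqP; split.
  by rewrite (_ : mkset _ = set0)//; apply/seteqP; split=> w //= /esym.
case/lastP: l => [|l s].
  rewrite (_ : mkset _ = set0)//; apply/seteqP; split=> w //=.
  by move/(congr1 size); rewrite size_rcons.
rewrite (_ : mkset _ = [set w | history s1 A T h w t = l] `&`
  [set w | decide A w [seq T v | v <- iota 1 t.+1] [seq h k | k <- iota 0 (phase_index T t.+1).+1] l = s]).
  by apply: measurableI; [exact: IHt | exact: measurable_decide].
apply/seteqP; split=> w /=; first by move/rcons_inj => [-> ->].
by move=> [-> ->].
Qed.

Lemma measurable_state T h t s : measurable [set w | state s1 A T h w t = s].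
Proof.
exact: (measurable_preimage_fibers [set l | last s1 l = s] (measurable_history _ _ _)).
Qed.

Lemma measurable_path_cost T h N :
  measurable_fun setT (fun w => path_cost T (state s1 A T h w) N).
Proof.
apply: measurable_sum => t.
apply: (measurable_fun_fibers (X := fun w => (state s1 A T h w t.-1, state s1 A T h w t))
  (fun u => (u.1 != u.2)%:R + T t u.2)) => -[s s'].
rewrite (_ : mkset _ = [set w | state s1 A T h w t.-1 = s] `&` [set w | state s1 A T h w t = s']).
  by apply: measurableI; exact: measurable_state.
by apply/seteqP; split=> w /= [-> ->].
Qed.

(** An algorithm that is in [g t] at time [t] must, at time [t.+1], either move or process the unit
    task there, so it pays at least 1. *)
Lemma expected_cost_ge (P : probability Omega R) (g : nat -> S) h N :
  (\sum_(0 <= t < N) P [set w | state s1 A (unit_tasks g) h w t = g t]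
   <= 'E_P[fun w => path_cost (unit_tasks g) (state s1 A (unit_tasks g) h w) N])%E.
Proof.
set T := unit_tasks g; rewrite expectation.unlock.
rewrite (eq_bigr (fun t => \int[P]_w (\1_[set w | state s1 A T h w t = g t] w)%:E)%E); last first.
  by move=> t _; rewrite integral_indic ?setIT//; exact: measurable_state.
have m_indic t : measurable_fun [set: Omega]
    (fun w => (\1_[set w | state s1 A T h w t = g t] w)%:E : \bar R).
  by apply/measurable_EFinP; apply: measurable_indic; exact: measurable_state.
rewrite -ge0_integral_sum//; apply: ge0_le_integral => //.
- by move=> w _; apply: sume_ge0.
- exact: emeasurable_sum.
- by apply/measurable_EFinP; exact: measurable_path_cost.
move=> w _; rewrite sumEFin lee_fin /path_cost big_add1/=.
apply: ler_sum => t _; rewrite indicE /T /unit_tasks/=.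
have [/set_mem/= ->|_] := boolP (w \in _); last by rewrite addr_ge0 ?ler0n.
by rewrite -natrD ler_nat eq_sym; case: eqP.
Qed.
End Histories.

(** * The harmonic sum and the greedy adversary *)

(** In the last [m] steps of a block, [n - t %% n] runs down from [m] to 1; it will be the number of
    unsaturated states. *)
Lemma sum_inv_block (R : realType) (n m K : nat) : (0 < n)%N -> (m <= n)%N ->
  \sum_(0 <= t < K * n)
    (if (t %% n < n - m)%N then 0 else ((n - t %% n)%:R^-1 : R)) =
  K%:R * \sum_(1 <= j < m.+1) j%:R^-1.
Proof.
move=> n_gt0 mn; elim: K => [|K IHK]; first by rewrite big_geq ?mul0r.
rewrite (big_cat_nat (n := (K * n)%N))//=; last by rewrite leq_pmul2r.
rewrite IHK -natr1 mulrDl mul1r; congr (_ + _).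
rewrite -{1}(add0n (K * n)%N) big_addn mulSn addnK big_nat_rev/=.
rewrite (big_cat_nat (n := m))//= [X in _ + X]big_nat_cond [X in _ + X]big1.
  rewrite addr0 big_add1/=; apply: eq_big_nat => i /andP[_ im].
  rewrite add0n addnC modnMDl modn_small; last by lia.
  by rewrite ifF; [congr (_%:R^-1) |]; lia.
move=> i /andP[/andP[mi i_n] _]; rewrite add0n addnC modnMDl modn_small ?ifT//; lia.
Qed.

Section GreedyAdversary.
Context {R : realType} {S : finType} {s1 : S}.
Context {d : measure_display} {Omega : measurableType d}.
Variables (P : probability Omega R) (A : rand_alg R S Omega) (m : nat).
Let n := #|S|.
Hypothesis mn : (m <= n)%N.

(** Each phase is predicted to saturate one state per step in the order of [enum_rank]; the
    successor reflects that [g t] is charged at time [t.+1]. *)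
Definition block_prediction : prediction_seq S :=
  fun k s => (k * #|S| + enum_rank s).+1.

Let h := block_prediction.

Let S_gt0 : (0 < n)%N.
Proof. by apply/card_gt0P; exists s1. Qed.

Lemma block_prediction_tie_free : tie_free h.
Proof. by move=> k s s' [] /addnI /val_inj /enum_rank_inj. Qed.

(** [occupancy] is taken at time [t], before the charge at time [t.+1]. It depends on [g] only
    through values below [t], so the condition is not circular. *)
Definition greedy (g : nat -> S) : Prop := forall t,
  let occupancy s := P [set w | state s1 A (unit_tasks g) h w t = s]%classic in
  let block := [seq g u | u <- index_iota (t %/ n * n) t] in
  if (t %% n < n - m)%N then enum_rank (g t) = (t %% n)%N :> nat
  else g t \notin block /\
    (forall s, s \notin block -> (occupancy s <= occupancy (g t))%E).

Lemma greedy_exists : exists g, greedy g.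
Proof.
(* The default [s1] of [nth] affects only tasks after time [size l], which the state at that time
   cannot depend on. *)
pose occ l s :=
  P [set w | state s1 A (unit_tasks (nth s1 l)) h w (size l) = s]%classic.
pose Q l s := let t := size l in
  if (t %% n < n - m)%N then enum_rank s = (t %% n)%N :> nat
  else s \notin drop (t %/ n * n) l /\
    (forall s', s' \notin drop (t %/ n * n) l -> (occ l s' <= occ l s)%E).
have /strong_dependent_choice[g gQ] l : exists s, Q l s.
  rewrite /Q; set t := size l.
  have tn : (t %% n < n)%N by rewrite ltn_pmod.
  case: ltnP => _; first by exists (enum_val (A := S) (Ordinal tn)); rewrite enum_valK.
  (* The current block contains only [t %% n < n] charges so far, so it misses some state. *)
  have [s0 s0P] : exists s, s \notin drop (t %/ n * n) l.
    apply/existsP; rewrite -negb_forall; apply/negP => /forallP all_in.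
    have := uniq_leq_size (enum_uniq S) (fun s _ => all_in s).
    by rewrite -cardE size_drop -/n leqNgt -/t {1}(divn_eq t n) addKn tn.
  case: (Order.TotalTheory.arg_maxP (P := [pred s | s \notin drop (t %/ n * n) l]) (occ l) s0P).
  by move=> s sP s_max; exists s.
exists g => t; have := gQ t; rewrite /Q size_mkseq /occ size_mkseq.
have -> : drop (t %/ n * n) (mkseq g t) = [seq g u | u <- index_iota (t %/ n * n) t].
  by rewrite /mkseq -map_drop drop_iota add0n.
have stateE w : state s1 A (unit_tasks (nth s1 (mkseq g t))) h w t =
    state s1 A (unit_tasks g) h w t.
  rewrite /state (@eq_history _ _ _ _ _ _ _ (unit_tasks g))// => u.
  rewrite inE => u_t; apply/funext => s.
  by rewrite /unit_tasks nth_mkseq//; lia.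
have occE s : P [set w | state s1 A (unit_tasks (nth s1 (mkseq g t))) h w t = s]%classic
    = P [set w | state s1 A (unit_tasks g) h w t = s]%classic.
  by congr (P _); apply/seteqP; split=> w /=; rewrite stateE.
case: ltnP => // _ [g_new g_max]; split=> // s s_new.
by rewrite -!occE; exact: g_max.
Qed.

Variable g : nat -> S.
Hypothesis g_greedy : greedy g.

Lemma greedy_rank k i : (i < n - m)%N -> enum_rank (g (k * n + i)%N) = i :> nat.
Proof.
move=> im; have := g_greedy (k * n + i)%N.
by rewrite modnMDl modn_small ?im//; lia.
Qed.

Lemma greedy_blocks : saturates_blocks g.
Proof.
move=> k i j; rewrite !inE -/n.
wlog ij : i j / (i <= j)%N.
  by move=> IH i_n j_n ijE; case/orP: (leq_total i j) => ?; [|symmetry]; exact: IH.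
move=> i_n j_n gE; have {}gE : g (k * n + i)%N = g (k * n + j)%N := gE.
apply/eqP; rewrite eqn_leq ij leqNgt; apply/negP => ltij.
(* In the predicted part the rank determines the position; afterwards each choice avoids the earlier
   part of the block. *)
have [jm|mj] := ltnP j (n - m).
  by have := greedy_rank k jm; rewrite -gE greedy_rank; lia.
have := g_greedy (k * n + j)%N.
rewrite modnMDl divnMDl// divn_small// addn0 modn_small// ltnNge mj/= => -[].
by move/negP => + _; apply; rewrite -gE; apply: map_f; rewrite mem_index_iota; lia.
Qed.

Lemma greedy_error eta0 : (m ^ 2 %/ 2 <= eta0)%N ->
  error_at_most eta0 (unit_tasks g : task_seq R S) h.
Proof.
move=> m_eta; apply: unit_tasks_error => //; first exact: greedy_blocks.
move=> k; apply: leq_trans m_eta.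
apply: leq_trans (sum_displacement (q := fun i : 'I_n => enum_rank (g (k * n + i)%N)) mn _ _).
- by apply: eq_leq; apply: eq_bigr => i _; rewrite /h /block_prediction -/n; lia.
- move=> i j /enum_rank_inj/greedy_blocks ijE; apply/val_inj/ijE; exact: ltn_ord.
- by move=> i im; apply/val_inj; exact: greedy_rank.
Qed.

Hypothesis A_bls : bls_phase s1 A.

Lemma greedy_occupancy t : (n - m <= t %% n)%N ->
  (((n - t %% n)%:R^-1)%:E <=
   P [set w | state s1 A (unit_tasks g) h w t = g t]%classic)%E.
Proof.
move=> mt; have tE := divn_eq t n; have tn := ltn_pmod t S_gt0.
set block := [seq g u | u <- index_iota (t %/ n * n) t].
have blockE : block = [seq g (t %/ n * n + i)%N | i <- iota 0 (t %% n)].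
  have -> : (t %% n = t - t %/ n * n)%N by lia.
  by rewrite /block /index_iota -[X in iota X _]addn0 iotaDl -map_comp.
have block_uniq : uniq block.
  rewrite blockE map_inj_in_uniq ?iota_uniq// => i j.
  rewrite !mem_iota => i_t j_t; apply: greedy_blocks; rewrite inE -/n; lia.
(* The algorithm can only be in one of the [n - t %% n] states outside [block]. *)
have <- : #|[predC block]| = (n - t %% n)%N.
  have := cardC [in block]; rewrite (card_uniqP block_uniq) -/n.
  rewrite {1}blockE size_map size_iota => cE.
  by apply: (@addnI (t %% n)%N); rewrite subnKC ?(ltnW tn).
have := g_greedy t; rewrite ltnNge mt/= => -[_ g_max].
apply: mode_prob_ge => [s|w|s]; [exact: measurable_state| |exact: g_max].
(* [bls_phase] constrains only positive times; at time 0 the block is empty. *)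
rewrite inE/= /block; have [->|t_gt0] := posnP t; first by rewrite div0n mul0n.
rewrite -(saturated_unit_tasks (R := R)).
rewrite -(phase_start_unit_tasks (R := R) greedy_blocks S_gt0).
have [] := A_bls w (valid_unit_tasks g) block_prediction_tie_free t.-1.
by rewrite prednK.
Qed.

Lemma greedy_expected_cost K :
  ((K%:R * \sum_(1 <= j < m.+1) j%:R^-1)%:E <=
   'E_P[fun w => path_cost (unit_tasks g)
                   (state s1 A (unit_tasks g) h w) (K * n)])%E.
Proof.
apply: le_trans (expected_cost_ge _ _ _ _ _).
rewrite -(sum_inv_block R K S_gt0 mn) -sumEFin; apply: lee_sum => t _.
by case: ltnP => [//|]; exact: greedy_occupancy.
Qed.
End GreedyAdversary.

(** * From the cost per phase to the competitive ratio *)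

Theorem theorem4 (R : realType) (eta0 : nat) (S : finType) (s1 : S)
    (d : measure_display) (Omega : measurableType d) (P : probability Omega R)
    (A : rand_alg R S Omega) :
  let m := Num.truncn (Num.sqrt (2 * eta0%:R + 1 : R)) in
  (m <= #|S|)%N ->
  bls_phase s1 A ->
  ~ (competitive_ratio s1 P eta0 A < (\sum_(1 <= j < m.+1) j%:R^-1)%:E)%E.
Proof.
move=> m mn A_bls /ereal_inf_lt[_ [w [c w_comp] <-]]; rewrite lte_fin => w_lt.
set H := \sum_(_ <= _ < _) _ in w_lt.
(* This yields [m > 0] and then [H > 0], so that [w] can be replaced by its maximum with 0 and stay
   below [H]. *)
have sqrt_ge1 : 1 <= Num.sqrt (2 * eta0%:R + 1 : R).
  by rewrite -[leLHS]sqrtr1 ler_sqrt// lerDr mulr_ge0 ?ler0n.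
have m_le : m%:R <= Num.sqrt (2 * eta0%:R + 1 : R) by rewrite truncn_le sqrtr_ge0.
have m_gt0 : (0 < m)%N by rewrite truncn_gt0.
have m_eta : (m ^ 2 %/ 2 <= eta0)%N.
  (* Rounding down absorbs the extra 1. *)
  suff : (m ^ 2 <= 2 * eta0 + 1)%N by lia.
  rewrite -(ler_nat R) natrX natrD natrM.
  by rewrite -[leRHS]sqr_sqrtr ?addr_ge0 ?mulr_ge0 ?ler0n// lerXn2r ?nnegrE ?ler0n ?sqrtr_ge0.
have H_gt0 : 0 < H.
  rewrite /H big_nat_recl//= ltr_pwDl ?invr_gt0 ?ltr0n//.
  by apply: sumr_ge0 => j _; rewrite invr_ge0 ler0n.
have [g g_greedy] := greedy_exists (s1 := s1) P A mn.
(* [w] may be negative, whereas [opt_cost] is only bounded from above. *)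
pose W := Num.max w 0.
have W_lt : W < H by rewrite /W gt_max w_lt.
have S_gt0 : (0 < #|S|)%N by exact: leq_trans mn.
have bound K : K%:R * H <= W * K.+1%:R + c.
  have := w_comp _ _ (valid_unit_tasks g) block_prediction_tie_free
    (greedy_error mn g_greedy m_eta) (K * #|S|)%N.
  move/(le_trans (greedy_expected_cost mn g_greedy A_bls K)); rewrite lee_fin.
  move/le_trans; apply; rewrite lerD2r.
  have opt_ge0 : 0 <= opt_cost s1 (unit_tasks g : task_seq R S) (K * #|S|).
    apply: lb_le_inf; first by exists (path_cost (unit_tasks g) (fun=> s1) (K * #|S|)); exists (fun=> s1).
    move=> _ [sigma _ <-]; apply: sumr_ge0 => t _.
    by rewrite addr_ge0 ?ler0n.
  have W_ge0 : 0 <= W by rewrite le_max lexx orbT.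
  apply: le_trans (_ : W * opt_cost s1 (unit_tasks g) (K * #|S|) <= _).
    by rewrite ler_wpM2r// le_max lexx.
  by rewrite ler_wpM2l// opt_cost_unit_tasks//; exact: greedy_blocks g_greedy.
(* [bound K] means [K * (H - W) <= W + c], which fails for large [K] because [H - W] is positive. *)
have := archi_boundP (_ : 0 <= `|(W + c) / (H - W)|) => /(_ (normr_ge0 _)).
set K := Num.bound _ => K_lt.
have : (W + c) / (H - W) < K%:R by rewrite (le_lt_trans (ler_norm _)).
rewrite ltr_pdivrMr ?subr_gt0// => /lt_le_trans.
have := bound K; rewrite -natr1 mulrDr mulr1 => bK /(_ _ (lexx _)).
lra.
Qed.
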